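(* Let $\nu>0$ and let $u$ be a smooth (classical) divergence-free solution of the incompressible Navier--Stokes equations $\partial_t u+(u\cdot\nabla)u-\nu\Delta u+\nabla p=0$, $\operatorname{div}u=0$, on $\mathbb{T}^3\times[0,T]$. Consider the joint common-noise operator $$\mathcal L_u^{(2)}=\partial_t+u(t,x)\cdot\nabla_x+u(t,y)\cdot\nabla_y-\nu(\nabla_x+\nabla_y)^2 .$$ In centre and separation variables $c=\tfrac{x+y}{2}$, $r=x-y$, $$(\nabla_x+\nabla_y)^2=\Delta_c,\qquad u(t,x)\cdot\nabla_x+u(t,y)\cdot\nabla_y=\frac{u_++u_-}{2}\cdot\nabla_c+(u_+-u_-)\cdot\nabla_r,$$ with $u_\pm=u(t,c\pm r/2)$. The diffusion in $\mathcal L_u^{(2)}$ therefore acts on the centre variable only; there is no $\Delta_r$. In particular the model equation $$\partial_tH-\nu(\nabla_x+\nabla_y)^2H=0$$ admits every bounded profile $H(t,x,y)=h(x-y)$ as a stationary solution, so no estimate can extract regularity in $x-y$ from the common-noise diffusion alone.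
   Context: $\mathbb{T}^3=\mathbb{R}^3/\mathbb{Z}^3$, and $(\nabla_x+\nabla_y)^2=\sum_{k=1}^3(\partial_{x_k}+\partial_{y_k})^2$ acts on functions of $(x,y)$. The ''common-noise diffusion'' is the term $-\nu(\nabla_x+\nabla_y)^2$. It arises because, in the stochastic flow $\mathrm{d}X_t(a)=u(t,X_t(a))\,\mathrm{d}t+\sqrt{2\nu}\,\mathrm{d}W_t$, a single Brownian motion $W$ drives all labels $a$. With $A_t=X_t^{-1}$, $J=\nabla A_t$, $V=u_0\circ A_t$ and $u_0$ the initial datum of $u$, the operator $\mathcal L_u^{(2)}$ is the one governing the two-point covariance $\mathbb{E}[(J(t,x)-\mathbb{E}J(t,x))^\top(V(t,y)-\mathbb{E}V(t,y))]$. *)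

(* Defs.v *)
From HB Require Import structures.
From mathcomp Require Import all_boot all_order all_algebra.
From mathcomp Require Import all_classical all_reals all_analysis.

Set Implicit Arguments.
Unset Strict Implicit.
Unset Printing Implicit Defensive.

Import Order.TTheory GRing.Theory Num.Theory.
Import numFieldNormedType.Exports.

Local Open Scope classical_set_scope.
Local Open Scope ring_scope.

(* C^n on a set D that is contained in the closure of its interior: f is
   differentiable in the interior of D, and f and its derivatives of order at
   most n extend continuously to D.  For D = setT this is C^n in the usual
   sense. The values of f outside D play no role. *)
Fixpoint Ck (R : realType) (X Y : normedModType R) (D : set X) (n : nat)
    (f : X -> Y) : Prop :=
  {within D, continuous f} /\
  if n is m.+1 then
    (forall p, interior D p -> differentiable f p) /\
    (forall v, exists2 g : X -> Y,
       (forall p, interior D p -> 'd f p v = g p) & Ck D m g)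
  else True.

Definition smooth (R : realType) (X Y : normedModType R) (D : set X)
    (f : X -> Y) : Prop := forall n, Ck D n f.

(* The library declares the product of two sigma-finite measures as a
   sigma-finite measure, but this instance is shadowed by the one for
   subprobabilities. *)
Section ProductMeasure.
Context d1 d2 (T1 : measurableType d1) (T2 : measurableType d2).
Context (R : realType).
Variable m1 : {sigma_finite_measure set T1 -> \bar R}.
Variable m2 : {sigma_finite_measure set T2 -> \bar R}.

Lemma sigma_finite_product : sigma_finite setT (m1 \x m2)%E.
Proof.
have /sigma_finiteP[F [TF ndF Foo]] := sigma_finiteT m1.
have /sigma_finiteP[G [TG ndG Goo]] := sigma_finiteT m2.
exists (fun n => F n `*` G n).
  rewrite -setXTT TF TG predeqE => -[x y]; split.
    move=> [/= [n _ Fnx] [k _ Gky]]; exists (maxn n k) => //; split.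
    - by move: x Fnx; exact/subsetPset/ndF/leq_maxl.
    - by move: y Gky; exact/subsetPset/ndG/leq_maxr.
  by move=> [n _ []/= ? ?]; split; exists n.
move=> k; have [? ?] := Foo k; have [? ?] := Goo k.
split; first exact: measurableX.
by rewrite product_measure1E// lte_mul_pinfty// ge0_fin_numE.
Qed.

Definition product_measure :
    {sigma_finite_measure set (T1 * T2)%type -> \bar R} :=
  HB.pack (m1 \x m2)%E
    (Measure_isSigmaFinite.Build _ _ _ (m1 \x m2)%E sigma_finite_product).

End ProductMeasure.

Section Operators.
Variable R : realType.
Local Notation V := 'rV[R]_3.

Definition e (k : 'I_3) : V := delta_mx 0 k.

(* Functions on the torus R^3 / Z^3 are Z^3-periodic functions on R^3. *)
Definition tperiodic (E : zmodType) (f : V -> E) : Prop :=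
  forall k, periodic f (e k).

Definition tperiodic2 (F : V -> V -> R) : Prop :=
  (forall y, tperiodic (F^~ y)) /\ (forall x, tperiodic (F x)).

(* [0, T] x X *)
Definition strip (X : Type) (T : R) : set (R * X) :=
  [set q | 0 <= q.1 <= T].

Definition divergence (w : V -> V) (x : V) : R :=
  \sum_(k < 3) ('D_(e k) w x) 0 k.

Definition gradient (q : V -> R) (x : V) : V := \row_k 'D_(e k) q x.

Definition laplacian (w : V -> V) (x : V) : V :=
  \sum_(k < 3) 'D_(e k) ('D_(e k) w) x.

Definition convection (w : V -> V) (x : V) : V :=
  \sum_(k < 3) (w x) 0 k *: 'D_(e k) w x.

Definition navier_stokes (nu T : R) (u : R -> V -> V) (p : R -> V -> R) :
    Prop :=
  [/\ smooth (strip T) (fun q : R * V => u q.1 q.2)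
    & smooth (strip T) (fun q : R * V => p q.1 q.2)] /\
  [/\ forall t, 0 <= t <= T -> tperiodic (u t),
      forall t, 0 <= t <= T -> tperiodic (p t),
      forall t x, 0 <= t <= T -> divergence (u t) x = 0
    & forall t x, 0 < t < T ->
        derive1 (fun s => u s x) t + convection (u t) x
          - nu *: laplacian (u t) x + gradient (p t) x = 0].

Definition d1 (k : 'I_3) (F : V -> V -> R) (x y : V) : R :=
  'D_(e k) (fun x' => F x' y) x.

Definition d2 (k : 'I_3) (F : V -> V -> R) (x y : V) : R :=
  'D_(e k) (fun y' => F x y') y.

Definition dsum (k : 'I_3) (F : V -> V -> R) (x y : V) : R :=
  d1 k F x y + d2 k F x y.

(* a . nabla_1 F and a . nabla_2 F *)
Definition advect1 (a : V) (F : V -> V -> R) (x y : V) : R :=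
  \sum_(k < 3) a 0 k * d1 k F x y.

Definition advect2 (a : V) (F : V -> V -> R) (x y : V) : R :=
  \sum_(k < 3) a 0 k * d2 k F x y.

(* (nabla_x + nabla_y)^2 *)
Definition common_diffusion (F : V -> V -> R) (x y : V) : R :=
  \sum_(k < 3) dsum k (dsum k F) x y.

(* Laplacian in the first of the two variables *)
Definition laplacian1 (F : V -> V -> R) (x y : V) : R :=
  \sum_(k < 3) d1 k (d1 k F) x y.

Definition two_point_op (nu : R) (u : R -> V -> V) (H : R -> V -> V -> R)
    (t : R) (x y : V) : R :=
  derive1 (fun s => H s x y) t
  + (advect1 (u t x) (H t) x y + advect2 (u t y) (H t) x y)
  - nu * common_diffusion (H t) x y.

(* F(x, y) as a function of (c, r), where x = c + r/2 and y = c - r/2.  On the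
   torus (c, r) is only a local chart, so F is taken on R^3 x R^3. *)
Definition in_cr (F : V -> V -> R) (c r : V) : R :=
  F (c + 2^-1 *: r) (c - 2^-1 *: r).

(* Solutions of the model equation
   d_t H - nu (nabla_x + nabla_y)^2 H = 0. *)

Definition smooth2 (D : set (R * (V * V))) (H : R -> V -> V -> R) : Prop :=
  smooth D (fun q : R * (V * V) => H q.1 q.2.1 q.2.2).

Definition smooth_model_solution (nu T : R) (H : R -> V -> V -> R) : Prop :=
  [/\ smooth2 (strip T) H,
      forall t, 0 <= t <= T -> tperiodic2 (H t)
    & forall t x y, 0 < t < T ->
        derive1 (fun s => H s x y) t - nu * common_diffusion (H t) x y = 0].

(* 'rV[R]_3 has no measurable structure in the library: its Borel sets and
   Lebesgue measure are those of R * R * R. *)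
Local Notation mR := (measurableTypeR R).
Local Notation mR3 := (mR * mR * mR)%type.

Definition vec (a : mR3) : V :=
  \row_(k < 3) nth (0 : R) [:: (a.1.1 : R); (a.1.2 : R); (a.2 : R)] k.

Definition leb1 : {sigma_finite_measure set mR -> \bar R} :=
  @lebesgue_measure R.

Definition leb3 : {sigma_finite_measure set mR3 -> \bar R} :=
  product_measure (product_measure leb1 leb1) leb1.

Definition leb6 : {sigma_finite_measure set (mR3 * mR3)%type -> \bar R} :=
  product_measure leb3 leb3.

Definition leb_time_space2 :
    {sigma_finite_measure set (mR * (mR3 * mR3))%type -> \bar R} :=
  product_measure leb1 leb6.

Definition unit_itv : set mR := [set s : R | 0 <= s <= 1].

(* fundamental domain of the torus, up to a null set *)
Definition cube : set mR3 := unit_itv `*` unit_itv `*` unit_itv.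

Definition open_slab (T : R) (A : set (mR3 * mR3)) :
    set (mR * (mR3 * mR3)) :=
  [set s : R | 0 < s < T] `*` A.

Definition borel (h : V -> R) : Prop :=
  measurable_fun setT (fun a : mR3 => h (vec a)).

(* Smooth functions on ]0, T[ x T^3 x T^3 with compact support *)
Definition test_function (T : R) (phi : R -> V -> V -> R) : Prop :=
  [/\ smooth2 setT phi,
      forall t, tperiodic2 (phi t)
    & exists a b : R, [/\ 0 < a, b < T &
        forall t x y, ~~ (a <= t <= b) -> phi t x y = 0]].

(* Distributional solutions in L^oo(]0, T[ x T^3 x T^3): d_t and
   d_x_k + d_y_k are antisymmetric, so the formal adjoint of
   d_t - nu (nabla_x + nabla_y)^2 is - d_t - nu (nabla_x + nabla_y)^2. *)
Definition weak_model_solution (nu T : R) (H : R -> V -> V -> R) : Prop :=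
  [/\ forall t, 0 < t < T -> tperiodic2 (H t),
      measurable_fun (open_slab T setT)
        (fun q => H q.1 (vec q.2.1) (vec q.2.2)),
      exists M : R, forall t x y, 0 < t < T -> `|H t x y| <= M
    & forall phi, test_function T phi ->
        (\int[leb_time_space2]_(q in open_slab T (cube `*` cube))
           (H q.1 (vec q.2.1) (vec q.2.2) *
            (- derive1 (fun s => phi s (vec q.2.1) (vec q.2.2)) q.1
             - nu * common_diffusion (phi q.1) (vec q.2.1) (vec q.2.2)))%:E
         = 0)%E].

(* L^1(T^3 x T^3) norm of the increment of F when the separation r = x - y is
   increased by z while the centre c = (x + y)/2 is kept fixed *)
Definition separation_increment (F : V -> V -> R) (z : V) : \bar R :=
  (\int[leb6]_(q in cube `*` cube)
     `| F (vec q.1 + 2^-1 *: z) (vec q.2 - 2^-1 *: z)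
        - F (vec q.1) (vec q.2) |%:E)%E.

End Operators.

(* Main.v *)
(* The map (x, y) -> (c, r) is linear and d_x_k + d_y_k is the derivative along
   (e_k, e_k), which moves c and fixes r; hence the change of variables is the
   chain rule, and a function of r = x - y is stationary.

   For a merely bounded profile h and a test function phi, the time derivative
   integrates to 0 by Fubini and the fundamental theorem of calculus.  As to the
   diffusion, with g = (d_x_k + d_y_k) phi the integral of
   h(x - y) (d_x_k + d_y_k) g over the torus is unchanged when x and y are
   translated by the same vector s e_k, the weight h(x - y) being invariant;
   averaging over 0 <= s <= 1 turns the derivative of g into a difference of g
   over a period, which is 0.

   Against a modulus of continuity, the waves M cos(2 pi n r_0) and
   M sin(2 pi n r_0) are smooth stationary solutions bounded by M which change
   sign when r_0 increases by 1 / 2n.  As |cos| + |sin| >= 1, their increments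
   add up to at least 2 M in L^1, however large n is. *)

Require Import Defs.
From HB Require Import structures.
From mathcomp Require Import all_boot all_order all_algebra.
From mathcomp Require Import all_classical all_reals all_analysis.
From mathcomp Require Import measurable_realfun ring lra.
Import Order.TTheory GRing.Theory Num.Theory.
Import numFieldNormedType.Exports.
Set Implicit Arguments.
Unset Strict Implicit.
Unset Printing Implicit Defensive.

Local Open Scope classical_set_scope.
Local Open Scope ring_scope.

(** * Calculus *)

Section Ck.
Variable R : realType.
Implicit Types X Y Z : normedModType R.

(** [l] carries the line through [x] along [v] to the line through [l x] along [w], so both sides
    are limits of the same difference quotients. The changes of variables in directional derivatives
    rest on this. *)
Lemma derive_line X Y Z (f : Y -> Z) (l : X -> Y) (x v : X) (w : Y) :
  (forall s : R, l (s *: v + x) = s *: w + l x) ->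
  'D_v (f \o l) x = 'D_w f (l x).
Proof.
by move=> lE; rewrite /derive /=; under eq_fun do rewrite lE.
Qed.

Lemma is_derive_line X (g : X -> R) (v p : X) (r : R) :
  differentiable g (p + r *: v) ->
  is_derive r 1 (fun s : R => g (p + s *: v)) ('D_v g (p + r *: v)).
Proof.
move=> dg; have dl : differentiable (fun s : R => p + s *: v) r.
  by apply: differentiableD => //; exact: differentiableZl.
apply: DeriveDef.
  apply/derivable1_diffP.
  exact: (@differentiable_comp _ _ _ _ (fun s : R => p + s *: v) g).
rewrite -[LHS]/('D_1 (g \o (fun s : R => p + s *: v)) r).
apply: derive_line => s.
by rewrite scalerDl [s *: _]mulr1 addrCA.
Qed.

Lemma derive_periodic X Y (g : X -> Y) (a v p : X) :
  (forall q, g (q + a) = g q) -> 'D_v g (p + a) = 'D_v g p.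
Proof.
by move=> ga; rewrite /derive /= ga; under eq_fun do rewrite addrA ga.
Qed.

Lemma Ck_continuous X Y n (f : X -> Y) : Ck setT n f -> continuous f.
Proof. by case: n => [|n] [+ _]; rewrite -continuous_subspace_setT. Qed.

(** [Ck] determines [g] only on the interior of the domain. On [setT] this is everywhere, so [g] is
    the derivative itself. *)
Lemma CkSP X Y n (f : X -> Y) : Ck setT n.+1 f ->
  (forall p, differentiable f p) /\ forall v, Ck setT n (fun p => 'd f p v).
Proof.
move=> [_ [df dfg]]; split=> [p|v]; first by apply: df; rewrite interiorT.
have [g fg Cg] := dfg v.
suff -> : (fun p => 'd f p v) = g by [].
by apply/funext => p; apply: fg; rewrite interiorT.
Qed.

Lemma CkW X Y n (f : X -> Y) : Ck setT n.+1 f -> Ck setT n f.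
Proof.
elim: n f => [|n IH] f Cf; first by split=> //; case: Cf.
have [df dfC] := CkSP Cf; split; first by case: Cf.
split=> [p _|v]; first exact: df.
by exists (fun p => 'd f p v) => //; exact/IH/dfC.
Qed.

Lemma smooth_diff X Y (f : X -> Y) (v : X) : smooth setT f ->
  smooth setT (fun p => 'd f p v).
Proof. by move=> sf n; apply: (CkSP (sf n.+1)).2. Qed.

Lemma smooth_differentiable X (g : X -> R) :
  smooth setT g -> forall p, differentiable g p.
Proof. by move=> sg; exact: (CkSP (sg 1)).1. Qed.

Lemma smooth_continuous X (g : X -> R) :
  smooth setT g -> continuous g.
Proof. by move=> sg; exact: Ck_continuous (sg 0). Qed.

Lemma smooth_derive X (g : X -> R) v :
  smooth setT g -> smooth setT ('D_v g).
Proof.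
move=> sg; have -> : 'D_v g = fun p => 'd g p v.
  by apply/funext => p; rewrite deriveE//; exact: smooth_differentiable.
exact: smooth_diff.
Qed.

(** The derivative of [f \o l] along [v] is that of [f] along [l v], composed with [l]: the shape is
    preserved and the induction closes. A general [D] covers the strip. *)
Lemma Ck_comp_linear X Y Z (D : set X) n (f : Y -> Z) (l : {linear X -> Y}) :
  continuous l -> Ck setT n f -> Ck D n (f \o l).
Proof.
move=> cl.
have ccomp (g : Y -> Z) : continuous g -> {within D, continuous g \o l}.
  move=> cg; apply: continuous_subspaceT => x.
  by apply: continuous_comp; [exact: cl|exact: cg].
elim: n f => [|n IH] f Cf; split=> //; try exact/ccomp/(Ck_continuous Cf).
have [df dfC] := CkSP Cf.
split=> [p _|v].
  by apply: differentiable_comp => //; exact: linear_differentiable.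
exists ((fun p => 'd f p (l v)) \o l); last exact/IH/dfC.
move=> p _; rewrite diff_comp//; last exact: linear_differentiable.
by rewrite /= diff_lin.
Qed.

End Ck.

(** * Centre and separation variables *)

Section TwoPoint.
Variable R : realType.
Local Notation V := 'rV[R]_3.
Implicit Types F : V -> V -> R.

Definition uncurry2 F : V * V -> R := fun q => F q.1 q.2.

Lemma d1E (k : 'I_3) F x y : d1 k F x y = 'D_(e R k, 0) (uncurry2 F) (x, y).
Proof.
apply: (@derive_line _ V (V * V)%type R (uncurry2 F) (pair^~ y)) => s.
by congr pair; rewrite /= scaler0 add0r.
Qed.

Lemma d2E (k : 'I_3) F x y : d2 k F x y = 'D_(0, e R k) (uncurry2 F) (x, y).
Proof.
apply: (@derive_line _ V (V * V)%type R (uncurry2 F) (pair x)) => s.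
by congr pair; rewrite /= scaler0 add0r.
Qed.

Lemma dsumE (k : 'I_3) F x y : differentiable (uncurry2 F) (x, y) ->
  dsum k F x y = 'd (uncurry2 F) (x, y) (e R k, e R k).
Proof.
move=> dF; rewrite /dsum d1E d2E !deriveE// -linearD.
by congr ('d _ _ _); congr pair; rewrite ?addr0 ?add0r.
Qed.

(** Moving [c] at fixed [r] moves [x] and [y] together by the same vector. *)
Lemma d1_in_cr (k : 'I_3) F :
  (forall q, differentiable (uncurry2 F) q) ->
  d1 k (in_cr F) = in_cr (dsum k F).
Proof.
move=> dF; apply/funext => c; apply/funext => r.
rewrite /in_cr dsumE// -deriveE//.
apply: (@derive_line _ V (V * V)%type R (uncurry2 F)
  (fun c => (c + 2^-1 *: r, c - 2^-1 *: r))) => s.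
by congr pair; rewrite addrA.
Qed.

(** Moving [r] at fixed [c] moves [x] by half the vector and [y] by the opposite half. *)
Lemma d2_in_cr (k : 'I_3) F :
  (forall q, differentiable (uncurry2 F) q) ->
  d2 k (in_cr F) = in_cr (fun x y => 2^-1 * (d1 k F x y - d2 k F x y)).
Proof.
move=> dF; apply/funext => c; apply/funext => r.
rewrite /in_cr [in RHS]d1E [in RHS]d2E !deriveE// -linearB -linearZ -deriveE//.
apply: (@derive_line _ V (V * V)%type R (uncurry2 F)
  (fun r => (c + 2^-1 *: r, c - 2^-1 *: r))) => s.
by congr pair; apply/matrixP => i j; rewrite !mxE /=; ring.
Qed.

Lemma centre_separation (x y : V) :
  (2^-1 *: (x + y) + 2^-1 *: (x - y) = x) *
  (2^-1 *: (x + y) - 2^-1 *: (x - y) = y).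
Proof.
by split; apply/matrixP => i j; rewrite !mxE; lra.
Qed.

(** [d1_in_cr] is applied to [F] and then to [dsum k F], which is differentiable because [F] is of
    class C^2. *)
Lemma common_diffusion_cr F (x y : V) : Ck setT 2 (uncurry2 F) ->
  common_diffusion F x y = laplacian1 (in_cr F) (2^-1 *: (x + y)) (x - y).
Proof.
move=> /CkSP[dF CF]; apply: eq_bigr => k _.
have dsF : uncurry2 (dsum k F) = fun q => 'd (uncurry2 F) q (e R k, e R k).
  by apply/funext => -[a b]; rewrite /uncurry2 /= dsumE.
have dds q : differentiable (uncurry2 (dsum k F)) q.
  by rewrite dsF; apply: (CkSP (CF _)).1.
by rewrite (d1_in_cr k dF) (d1_in_cr k dds) /in_cr !centre_separation.
Qed.

(** In each coordinate this is [a p + b q = (a + b) / 2 (p + q) + (a - b) (p - q) / 2], with [p] and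
    [q] the two partial derivatives. *)
Lemma transport_cr (a b : V) F (x y : V) : Ck setT 1 (uncurry2 F) ->
  advect1 a F x y + advect2 b F x y =
  advect1 (2^-1 *: (a + b)) (in_cr F) (2^-1 *: (x + y)) (x - y)
  + advect2 (a - b) (in_cr F) (2^-1 *: (x + y)) (x - y).
Proof.
move=> /CkSP[dF _]; rewrite -!big_split; apply: eq_bigr => k _ /=.
rewrite (d1_in_cr k dF) (d2_in_cr k dF) /in_cr !centre_separation /dsum !mxE.
by field.
Qed.

End TwoPoint.

(** * Smooth profiles and trigonometric waves *)

Section Profiles.
Variable R : realType.
Local Notation V := 'rV[R]_3.

(** The time is kept as an argument so that the solution with profile [h] is [h \o separation], to
    which [Ck_comp_linear] applies. *)
Definition separation (q : R * (V * V)) : V := q.2.1 - q.2.2.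

Fact separation_is_linear : linear separation.
Proof.
move=> a p q; rewrite /separation /= scalerBr opprD !addrA; congr (_ - _).
by rewrite -!addrA; congr (_ + _); rewrite addrC.
Qed.

HB.instance Definition _ :=
  GRing.isLinear.Build R (R * (V * V))%type V *:%R separation
    separation_is_linear.

Lemma continuous_separation : continuous separation.
Proof.
by move=> q; apply: cvgB;
  (apply: (@cvg_comp _ _ _ snd _ (nbhs q) (nbhs q.2)); first exact: cvg_snd);
  [exact: cvg_fst|exact: cvg_snd].
Qed.

(** Shifting [x] by [e R k] shifts [x - y] by [e R k], shifting [y] shifts it by [- e R k]; the two
    derivatives cancel by linearity of the differential. *)
Lemma dsum_separation (k : 'I_3) (h : V -> R) :
  (forall r, differentiable h r) ->
  dsum k (fun x y => h (x - y)) = fun _ _ => 0.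
Proof.
move=> dh; apply/funext => x; apply/funext => y; rewrite /dsum /d1 /d2.
rewrite (@derive_line _ _ _ _ h (fun x' => x' - y) x (e R k) (e R k));
  last by move=> s; rewrite addrA.
rewrite (@derive_line _ _ _ _ h (fun y' => x - y') y (e R k) (- e R k));
  last by move=> s; rewrite opprD addrCA scalerN.
by rewrite !deriveE// linearN subrr.
Qed.

Lemma common_diffusion_separation (h : V -> R) :
  (forall r, differentiable h r) ->
  common_diffusion (fun x y => h (x - y)) = fun _ _ => 0.
Proof.
move=> dh; apply/funext => x; apply/funext => y.
rewrite /common_diffusion big1// => k _; rewrite dsum_separation//.
by rewrite /dsum /d1 /d2 !derive_cst addr0.
Qed.

Lemma tperiodic2_separation (h : V -> R) : tperiodic h ->
  tperiodic2 (fun x y => h (x - y)).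
Proof.
move=> ph; split=> [y k x|x k y]; first by rewrite addrAC ph.
by rewrite -[LHS](ph k) opprD addrA subrK.
Qed.

Lemma smooth_profile_solution (nu T : R) (h : V -> R) :
  tperiodic h -> smooth setT h ->
  smooth_model_solution nu T (fun _ x y => h (x - y)).
Proof.
move=> ph sh; split=> [n|t _|t x y _].
- exact: (Ck_comp_linear _ continuous_separation (sh n)).
- exact: tperiodic2_separation.
- rewrite derive1_cst common_diffusion_separation ?mulr0 ?subrr//.
  exact: smooth_differentiable.
Qed.

(** This family is closed under differentiation, [(a, b)] becoming [(b, - a)], so smoothness follows
    by induction on the order. *)
Definition trig (a b s : R) : R := a * cos s + b * sin s.

Lemma is_derive_trig (a b s : R) : is_derive s 1 (trig a b) (trig b (- a) s).
Proof.
rewrite /trig; apply: is_derive_eq; rewrite /GRing.scale /=; ring.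
Qed.

Lemma smooth_trig (a b : R) : smooth setT (trig a b).
Proof.
have dtrig c d s : differentiable (trig c d) s.
  by apply/derivable1_diffP; apply: ex_derive; exact: is_derive_trig.
move=> n; elim: n a b => [|n IH] c d; split=> //.
- by apply: continuous_subspaceT => s; exact: differentiable_continuous.
- by apply: continuous_subspaceT => s; exact: differentiable_continuous.
split=> // v; exists (trig (v * d) (- (v * c))); last exact: IH.
move=> s _; rewrite deriv1E; last by apply: ex_derive; exact: is_derive_trig.
rewrite derive1E (@derive_val _ _ _ _ _ _ _ (is_derive_trig c d s)) /trig.
by rewrite /GRing.scale /=; ring.
Qed.

Definition phase (k : R) (r : V) : R := k * r 0 0.

Fact phase_is_linear (k : R) : linear (phase k).
Proof. move=> a p q; rewrite /phase !mxE /GRing.scale /=; ring. Qed.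

HB.instance Definition _ (k : R) :=
  GRing.isLinear.Build R V R *:%R (phase k) (phase_is_linear k).

Lemma smooth_trig_phase (a b k : R) :
  smooth setT (trig a b \o phase k).
Proof.
move=> n; apply: Ck_comp_linear; last exact: smooth_trig.
move=> r; apply: differentiable_continuous.
by apply: differentiableM => //; exact: differentiable_coord.
Qed.

Lemma periodic_trig_phase (a b : R) (n : nat) :
  tperiodic (trig a b \o phase (pi *+ 2 *+ n)).
Proof.
have ptrig : periodic (trig a b) (pi *+ 2).
  by move=> s; rewrite /trig cosD2pi sinD2pi.
move=> k r; rewrite /= /phase !mxE /= mulrDr.
by case: (0 == k); rewrite /= ?mulr0 ?addr0// mulr1 periodicn.
Qed.

(** The shift is half a wavelength: it advances the phase by exactly [pi]. *)
Lemma trig_half_period (a b : R) (n : nat) (r : V) : (0 < n)%N ->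
  (trig a b \o phase (pi *+ 2 *+ n)) (r + (2 * n%:R)^-1 *: e R 0) =
  - (trig a b \o phase (pi *+ 2 *+ n)) r.
Proof.
move=> n0; rewrite /= /phase !mxE /= mulrDr mulr1.
have -> : pi *+ 2 *+ n * (2 * n%:R)^-1 = pi :> R.
  rewrite -mulrnA -(mulr_natr pi) natrM mulfK// mulf_neq0// pnatr_eq0//.
  by rewrite -lt0n.
by rewrite /trig cosDpi sinDpi; ring.
Qed.

End Profiles.

(** * Invariance of integrals under translations of the torus *)

Section Rectangles.
Context d1 d2 (T1 : measurableType d1) (T2 : measurableType d2) (R : realType).
Variable m1 : {sigma_finite_measure set T1 -> \bar R}.
Variable m2 : {sigma_finite_measure set T2 -> \bar R}.
Variables (A : set T1) (B : set T2).
Hypotheses (mA : measurable A) (mB : measurable B).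
Local Open Scope ereal_scope.
Implicit Types f : T1 * T2 -> \bar R.

(** Extension by zero off a rectangle can be done one variable at a time; this transfers Fubini's
    theorem from the whole space to rectangles. *)
Lemma restrict_setX f x y :
  (f \_ (A `*` B)) (x, y) =
  ((fun x => ((fun y => f (x, y)) \_ B) y) \_ A) x.
Proof.
rewrite /patch in_setX /=.
by case: (x \in A); case: (y \in B).
Qed.

Lemma restrict_integral2 f x :
  \int[m2]_y (f \_ (A `*` B)) (x, y) =
  ((fun x => \int[m2]_(y in B) f (x, y)) \_ A) x.
Proof.
under eq_integral do rewrite restrict_setX.
rewrite /patch; case: (x \in A); last by rewrite integral0.
by rewrite [RHS]integral_mkcond.
Qed.

Lemma restrict_integral1 f y :
  \int[m1]_x (f \_ (A `*` B)) (x, y) =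
  ((fun y => \int[m1]_(x in A) f (x, y)) \_ B) y.
Proof.
under eq_integral do rewrite restrict_setX.
rewrite /patch; case: (y \in B).
  by rewrite [RHS]integral_mkcond.
by apply: integral0_eq => x _; case: (x \in A).
Qed.

Lemma tonelli_setX f : measurable_fun setT f -> (forall q, 0 <= f q) ->
  \int[product_measure m1 m2]_(q in A `*` B) f q =
  \int[m1]_(x in A) \int[m2]_(y in B) f (x, y).
Proof.
move=> mf f0; rewrite integral_mkcond fubini_tonelli1.
- by rewrite [RHS]integral_mkcond; apply: eq_integral => x _;
    rewrite /fubini_F restrict_integral2.
- apply/(measurable_restrictT _ _).1; first exact: measurableX.
  exact: measurable_funTS.
- by move=> q; rewrite /patch; case: ifP.
Qed.

Lemma measurable_tonelli_setX f : measurable_fun setT f ->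
  (forall q, 0 <= f q) ->
  measurable_fun setT (fun x => \int[m2]_(y in B) f (x, y)).
Proof.
move=> mf f0.
have : measurable_fun setT (fubini_F m2 (f \_ (setT `*` B))).
  apply: measurable_fun_fubini_tonelli_F.
  - apply/(measurable_restrictT _ _).1; first exact: measurableX.
    exact: measurable_funTS.
  - by move=> q; rewrite /patch; case: ifP.
congr (measurable_fun _ _); apply/funext => x.
rewrite [RHS]integral_mkcond.
by apply: eq_integral => y _; rewrite /patch in_setX in_setT.
Qed.

Lemma fubini_setX f : (product_measure m1 m2).-integrable (A `*` B) f ->
  \int[product_measure m1 m2]_(q in A `*` B) f q =
    \int[m1]_(x in A) \int[m2]_(y in B) f (x, y) /\
  \int[product_measure m1 m2]_(q in A `*` B) f q =
    \int[m2]_(y in B) \int[m1]_(x in A) f (x, y).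
Proof.
move=> /integrable_mkcond -/(_ (measurableX mA mB)) fi.
rewrite integral_mkcond; split.
  rewrite -integral12_prod_meas1//= [RHS]integral_mkcond.
  by apply: eq_integral => x _; rewrite /fubini_F restrict_integral2.
rewrite -integral21_prod_meas1//= [RHS]integral_mkcond.
by apply: eq_integral => y _; rewrite /fubini_G restrict_integral1.
Qed.

End Rectangles.

(** * Measure-preserving maps and translations of the circle *)

Section Preserving.
Context (R : realType).
Local Open Scope ereal_scope.

(** Invariance is stated for integrals of nonnegative functions rather than for measures of sets, a
    form that Tonelli's theorem carries over to products. *)
Definition preserving d (T : measurableType d)
    (m : {measure set T -> \bar R}) (A : set T) (g : T -> T) :=
  measurable_fun setT g /\
  forall f : T -> \bar R, measurable_fun setT f -> (forall x, 0 <= f x) ->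
    \int[m]_(x in A) f (g x) = \int[m]_(x in A) f x.

Lemma preserving_integral d (T : measurableType d)
    (m : {measure set T -> \bar R}) (A : set T) (g : T -> T) (f : T -> \bar R) :
  preserving m A g -> measurable_fun setT f ->
  \int[m]_(x in A) f (g x) = \int[m]_(x in A) f x.
Proof.
move=> [mg pg] mf; rewrite -[LHS]/(\int[m]_(x in A) (f \o g) x).
rewrite integralE [RHS]integralE funepos_comp funeneg_comp; congr (_ - _).
  by apply: pg => //; exact: measurable_funepos.
by apply: pg => //; exact: measurable_funeneg.
Qed.

(** By Tonelli, [g2] is absorbed at fixed [g1 x], and [g1] is then absorbed in the partial integral
    over [B]. *)
Lemma preserving_prod d1 d2 (T1 : measurableType d1) (T2 : measurableType d2)
    (m1 : {sigma_finite_measure set T1 -> \bar R})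
    (m2 : {sigma_finite_measure set T2 -> \bar R})
    (A : set T1) (B : set T2) (g1 : T1 -> T1) (g2 : T2 -> T2) :
  measurable A -> measurable B ->
  preserving m1 A g1 -> preserving m2 B g2 ->
  preserving (product_measure m1 m2) (A `*` B) (fun q => (g1 q.1, g2 q.2)).
Proof.
move=> mA mB [mg1 pg1] [mg2 pg2].
have mg : measurable_fun setT (fun q : T1 * T2 => (g1 q.1, g2 q.2)).
  by apply: measurable_fun_pair => /=; exact: measurableT_comp.
split=> // f mf f0.
rewrite (@tonelli_setX _ _ _ _ _ m1 m2 A B mA mB
  (fun q => f (g1 q.1, g2 q.2)))//; last exact: measurableT_comp mf mg.
rewrite tonelli_setX// -(pg1 (fun x => \int[m2]_(y in B) f (x, y))).
- apply: eq_integral => x _ /=.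
  by rewrite (pg2 (fun y => f (g1 x, y)))//; exact: measurableT_comp.
- exact: measurable_tonelli_setX.
- by move=> x; exact: integral_ge0.
Qed.

End Preserving.

Section TorusShift.
Variable R : realType.
Local Notation mR := (measurableTypeR R).

(* The translation by s of the torus R / Z, for 0 <= s <= 1, read in [0, 1]. *)
Definition tshift (s : R) (a : mR) : mR :=
  if a + s < 1 then a + s else a + s - 1.

Lemma unit_itvE : @unit_itv R = `[0%R, 1%R]%classic.
Proof. by apply/seteqP; split=> x; rewrite /= in_itv. Qed.

Local Open Scope ereal_scope.

(** The push-forward of Lebesgue measure by a translation agrees with it on half-open intervals,
    hence on all measurable sets. *)
Lemma integral_translate (c : R) (D : set mR) (f : mR -> \bar R) :
  measurable D -> measurable_fun setT f ->
  (forall a, 0 <= f a) ->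
  \int[@lebesgue_measure R]_(a in (+%R^~ c) @^-1` D) f (a + c)%R =
  \int[@lebesgue_measure R]_(a in D) f a.
Proof.
move=> mD mf f0.
have mc : measurable_fun setT (+%R^~ c : mR -> mR).
  by apply: continuous_measurable_fun => x; apply: cvgD => //; exact: cvg_cst.
rewrite -(ge0_integral_pushforward mc)//; last exact: measurable_funTS.
apply: eq_measure_integral => X mX _.
apply/esym; apply: lebesgue_measure_unique => // {mX}X [[a b]]/= _ <-.
rewrite /pushforward [X in _ = _ X](_ : _ = `](a - c)%R, (b - c)%R]%classic);
    last first.
  by apply/seteqP; split=> x; rewrite /= !in_itv/= ltrBlDr lerBrDr.
by rewrite !lebesgue_measure_itv/= !lte_fin ltrD2r -!EFinD opprB addrA subrK.
Qed.

(** The map exchanges two pieces of the unit interval: [[0, 1 - s[] goes to [[s, 1[] and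
    [[1 - s, 1]] to [[0, s]]. On each it is an ordinary translation, and the endpoints are null. *)
Lemma preserving_tshift (s : R) : (0 <= s <= 1)%R ->
  preserving (@leb1 R) (@unit_itv R) (tshift s).
Proof.
move=> /andP[s0 s1].
have mts : measurable_fun setT (tshift s).
  apply: measurable_fun_if => //=.
  - by apply: measurable_fun_ltr => //; apply: measurable_funD.
  - by apply: measurable_funD.
  - by apply: measurable_funB => //; apply: measurable_funD.
split=> // f mf f0.
have mft : measurable_fun setT (fun a => f (tshift s a)).
  exact: measurableT_comp mf mts.
have splitI c (g : mR -> \bar R) : (0 <= c <= 1)%R ->
    measurable_fun setT g ->
    \int[@lebesgue_measure R]_(a in `[0%R, 1%R]) g a =
    \int[@lebesgue_measure R]_(a in `[0%R, c[) g a +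
    \int[@lebesgue_measure R]_(a in `[c, 1%R]) g a.
  move=> /andP[c0 c1] mg.
  rewrite (@itv_bndbnd_setU _ _ _ (BLeft c)) ?bnd_simp//.
  rewrite integral_setU//; first exact: measurable_funTS.
  apply/disj_setPRL => x /=; rewrite !in_itv/= => /andP[cx _].
  by rewrite ltNge cx andbF.
rewrite unit_itvE /leb1 (splitI (1 - s)%R)//; last first.
  by rewrite subr_ge0 s1 lerBlDr lerDl.
rewrite [RHS](splitI s) ?s0// addeC; congr (_ + _).
- rewrite [RHS]integral_itv_bndo_bndc//; last exact: measurable_funTS.
  rewrite -[RHS](@integral_translate (s - 1))//.
  rewrite [X in _ = integral _ X _](_ : _ = `[(1 - s)%R, 1%R]%classic).
    apply: eq_integral => a; rewrite inE/= in_itv/= => /andP[sa _].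
    by rewrite /tshift ltNge -lerBlDr sa addrA.
  apply/seteqP; split=> x; rewrite /= !in_itv/=; lra.
- rewrite -[RHS]integral_itv_bndo_bndc//; last exact: measurable_funTS.
  rewrite -[RHS](@integral_translate s)//.
  rewrite [X in _ = integral _ X _](_ : _ = `[0%R, (1 - s)%R[%classic).
    apply: eq_integral => a; rewrite inE/= in_itv/= => /andP[_ sa].
    by rewrite /tshift -ltrBrDr sa.
  by apply/seteqP; split=> x; rewrite /= !in_itv/=; lra.
Qed.

End TorusShift.

(** * Bounded profiles *)

(** Every preimage is a countable union of fibres of [g]. *)
Lemma measurable_countable_factor d d' (T : measurableType d)
    (U : measurableType d') (C : countType) (g : T -> C) (F : C -> U) :
  (forall c, measurable (g @^-1` [set c])) -> measurable_fun setT (F \o g).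
Proof.
move=> mg _ Y mY; rewrite setTI.
have -> : (F \o g) @^-1` Y =
    \bigcup_c (g @^-1` [set c] `&` [set _ | Y (F c)]).
  apply/seteqP; split=> [x YFx|x [c _ [/= <-//]]].
  by exists (g x).
apply: countable_bigcupT_measurable => // c; apply: measurableI => //.
have [Yc|Yc] := pselect (Y (F c)).
  by rewrite [X in measurable X](_ : _ = setT)//; apply/seteqP; split.
by rewrite [X in measurable X](_ : _ = set0)//; apply/seteqP; split.
Qed.

(** * Measurability and bounds for continuous functions *)

Section Coordinates.
Variable R : realType.
Local Notation V := 'rV[R]_3.
Local Notation mR := (measurableTypeR R).
Local Notation mR3 := (mR * mR * mR)%type.

(** Integration takes place on products of [mR], calculus on the normed space [R * (V * V)]; this
    map links the two. *)
Definition embed (q : mR * (mR3 * mR3)) : R * (V * V) :=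
  ((q.1 : R), (vec q.2.1, vec q.2.2)).

Lemma vecE (a : mR3) :
  vec a = (a.1.1 : R) *: e R 0 + (a.1.2 : R) *: e R 1 + (a.2 : R) *: e R 2.
Proof.
by apply/rowP => -[[|[|[|//]]] lti];
  rewrite !mxE /= ?(mulr1, mulr0, addr0, add0r).
Qed.

(* 'rV[R]_3 is not a measurable type: continuous functions of time and space are
   shown to be measurable by rounding each coordinate down to a multiple of
   1 / (n + 1), which leaves countably many values. *)
Definition level (n : nat) (x : mR) : int := Num.floor ((x : R) * n.+1%:R).

Definition grid (n : nat) (k : int) : mR := k%:~R / n.+1%:R.

Lemma measurable_level n k : measurable (level n @^-1` [set k]).
Proof.
have -> : level n @^-1` [set k] =
    `[(k%:~R / n.+1%:R : R), ((k + 1)%:~R / n.+1%:R : R)[%classic.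
  apply/seteqP; split=> x;
    rewrite /level/= in_itv/= ler_pdivrMr// ltr_pdivlMr//.
    by move=> <-; exact: floor_itv.
  by move=> ?; exact: floor_def.
exact: measurable_itv.
Qed.

(** Rounding down loses at most [harmonic n], that is 1 / (n + 1). *)
Lemma cvg_grid_level (x : R) : grid n (level n x) @[n --> \oo] --> x.
Proof.
apply: (@squeeze_cvgr _ _ _ _ (fun n => x - harmonic n) (fun=> x)).
- near=> n; rewrite /grid /level ler_pdivrMr// floor_le andbT.
  rewrite ler_pdivlMr// mulrBl /harmonic /= mulVf// lerBlDr.
  by have := floorD1_gt (x * n.+1%:R); rewrite intrD => /ltW.
- rewrite -[X in _ --> X]subr0; apply: cvgB; first exact: cvg_cst.
  exact: cvg_harmonic.
- exact: cvg_cst.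
Unshelve. all: by end_near. Qed.

Definition level3 n (a : mR3) : int * int * int :=
  (level n a.1.1, level n a.1.2, level n a.2).

Definition grid3 n (k : int * int * int) : mR3 :=
  (grid n k.1.1, grid n k.1.2, grid n k.2).

Lemma measurable_level3 n k : measurable (level3 n @^-1` [set k]).
Proof.
rewrite [X in measurable X](_ : _ = level n @^-1` [set k.1.1] `*`
    (level n @^-1` [set k.1.2]) `*` (level n @^-1` [set k.2])).
  by do !apply: measurableX => //; exact: measurable_level.
case: k => -[k1 k2] k3; apply/seteqP.
by split=> -[[a1 a2] a3] /=;
  [case=> <- <- <-|case=> [[]]; rewrite /level3/= => -> -> ->].
Qed.

Lemma cvg_vec_grid_level3 (a : mR3) :
  vec (grid3 n (level3 n a)) @[n --> \oo] --> vec a.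
Proof.
rewrite vecE; under eq_fun do rewrite vecE.
by apply: cvgD; [apply: cvgD|]; apply: cvgZr_tmp; exact: cvg_grid_level.
Qed.

Lemma measurable_embed (f : R * (V * V) -> R) : continuous f ->
  measurable_fun setT (f \o embed).
Proof.
move=> cf.
pose lev n (q : mR * (mR3 * mR3)) :=
  (level n q.1, (level3 n q.2.1, level3 n q.2.2)).
pose gri n (k : int * ((int * int * int) * (int * int * int))) :=
  (grid n k.1, (grid3 n k.2.1, grid3 n k.2.2)).
apply: (@measurable_fun_cvg _ _ _ _ (fun n => (f \o embed \o gri n) \o lev n)
  (f \o embed)) => [n|q _].
  apply: measurable_countable_factor => -[k1 [k2 k3]].
  rewrite [X in measurable X](_ : _ = level n @^-1` [set k1] `*`
      (level3 n @^-1` [set k2] `*` (level3 n @^-1` [set k3]))).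
    apply: measurableX; first exact: measurable_level.
    by apply: measurableX; exact: measurable_level3.
  apply/seteqP.
  by split=> -[a1 [a2 a3]] /=;
    [case=> <- <- <-|case=> + []; rewrite /lev/= => -> -> ->].
case: q => t [a b].
have ct : (grid n (level n t) : R) @[n --> \oo] --> (t : R).
  exact: cvg_grid_level.
have ca := @cvg_vec_grid_level3 a; have cb := @cvg_vec_grid_level3 b.
exact: (cvg_comp _ _ (cvg_pair ct (cvg_pair ca cb)) (cf (_, (_, _)))).
Qed.

Lemma bounded_embed (f : R * (V * V) -> R) (a b : R) : continuous f ->
  exists M : R, forall q, (`[a, b]%classic `*` (@cube R `*` @cube R)) q ->
    `|f (embed q)| <= M.
Proof.
(* The bound comes from compactness of [K], the unit cube of row vectors, into which [vec] maps
   [cube]. *)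
move=> cf; pose K : set V := [set v | forall i, `[0 : R, 1]%classic (v ord0 i)].
have cK : compact K.
  apply: (@rV_compact _ _ (fun=> `[0 : R, 1]%classic)) => _.
  exact: segment_compact.
have cubeK a' : cube a' -> K (vec a').
  move=> [[/= ? ?] ?] -[[|[|[|//]]] lti]; by rewrite /= mxE /= in_itv.
have : bounded_set (f @` (`[a, b]%classic `*` (K `*` K))).
  apply: compact_bounded; apply: continuous_compact.
    exact: continuous_subspaceT.
  by apply: compact_setX; [exact: segment_compact|exact: compact_setX].
(* [bounded_set] provides as bounds all numbers strictly above [M]. *)
move=> [M [_ MP]]; exists (M + 1) => q [q1 [q2 q3]].
apply: (MP (M + 1)); first by rewrite ltrDl.
by exists (embed q) => //; split => //; split; exact: cubeK.
Qed.

End Coordinates.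

(** * Weighted integrals of derivatives *)

Section IntegralOfDerivative.
Variable R : realType.
Local Notation V := 'rV[R]_3.
Local Notation mR := (measurableTypeR R).
Local Notation mR3 := (mR * mR * mR)%type.

Lemma measurable_unit_itv : measurable (@unit_itv R).
Proof. by rewrite unit_itvE; exact: measurable_itv. Qed.

Lemma measurable_cube : measurable (@cube R).
Proof. by do !apply: measurableX; exact: measurable_unit_itv. Qed.

Lemma measurable_cube2 : measurable (@cube R `*` @cube R).
Proof. by apply: measurableX; exact: measurable_cube. Qed.

Lemma leb1_unit_itv : leb1 R (@unit_itv R) = 1%E.
Proof.
by rewrite unit_itvE /leb1/= lebesgue_measure_itv/= lte_fin ltr01 sube0.
Qed.

Lemma leb6_cube2 : leb6 R (@cube R `*` @cube R) = 1%E.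
Proof.
have leb3_cube : leb3 R (@cube R) = 1%E.
  rewrite [LHS]product_measure1E; last exact: measurable_unit_itv.
    rewrite [X in (X * _)%E]product_measure1E; try exact: measurable_unit_itv.
    by rewrite !leb1_unit_itv !mule1; exact: leb1_unit_itv.
  by apply: measurableX; exact: measurable_unit_itv.
rewrite [LHS]product_measure1E; try exact: measurable_cube.
by rewrite !leb3_cube mule1; exact: leb3_cube.
Qed.

(** A bounded measurable integrand on a set of finite measure. The weight [w], which does not depend
    on time, will be [h (x - y)]. *)
Lemma integrable_embed (w : mR3 * mR3 -> R) (F : R * (V * V) -> R)
    (a b : R) :
  measurable_fun setT w -> (exists M : R, forall q, `|w q| <= M) ->
  continuous F ->
  (leb_time_space2 R).-integrable (`[a, b]%classic `*` (@cube R `*` @cube R))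
    (fun q => (w q.2 * F (embed q))%:E).
Proof.
move=> mw [M wM] cF.
have mD : measurable (`[a, b]%classic `*` (@cube R `*` @cube R)
    : set (mR * (mR3 * mR3))).
  by apply: measurableX; [exact: measurable_itv|exact: measurable_cube2].
apply: measurable_bounded_integrable => //.
- rewrite [X in (X < _)%E]product_measure1E; last exact: measurable_cube2.
    rewrite leb6_cube2 mule1 /leb1/= lebesgue_measure_itv/=.
    by case: ifP => // _; rewrite -EFinB ltry.
  exact: measurable_itv.
- apply: measurable_funTS; apply: measurable_funM.
    exact: measurableT_comp.
  exact: measurable_embed.
- have [N FN] := bounded_embed a b cF.
  exists (M * N); split; first exact: num_real.
  move=> x MNx q Dq /=; apply: le_trans (ltW MNx); rewrite normrM.
  by rewrite ler_pM//; exact: FN.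
Qed.

(** At fixed [q] the weight is a constant, and the fundamental theorem of calculus leaves [w q]
    times a vanishing increment of [G]. The first variable will be the time in one use and a
    translation parameter in the other. *)
Lemma integral_derivative_eq0 (w : mR3 * mR3 -> R)
    (G F : R * (V * V) -> R) (a b : R) : a < b ->
  measurable_fun setT w -> (exists M : R, forall q, `|w q| <= M) ->
  continuous F ->
  (forall (p : V * V) (r : R), is_derive r 1 (fun s => G (s, p)) (F (r, p))) ->
  (forall p, G (b, p) = G (a, p)) ->
  (\int[leb_time_space2 R]_(q in `[a, b]%classic `*` (@cube R `*` @cube R))
    (w q.2 * F (embed q))%:E = 0)%E.
Proof.
move=> ab mw wM cF dG Gab.
have intF := integrable_embed a b mw wM cF.
(* The order is chosen so that the inner integral is over the first variable. *)
rewrite (fubini_setX _ _ intF).2;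
  [|exact: measurable_itv|exact: measurable_cube2].
apply: integral0_eq => q _ /=.
set p := (vec q.1, vec q.2).
have dwG (r : R) : is_derive r 1 (fun s => w q * G (s, p)) (w q * F (r, p)).
  exact: is_deriveZ.
have cwG : continuous (fun s => w q * G (s, p)).
  move=> r; apply/differentiable_continuous/derivable1_diffP.
  exact: (@ex_derive _ _ _ _ _ _ _ (dwG r)).
transitivity ((w q * G (b, p))%:E - (w q * G (a, p))%:E)%E; last first.
  by rewrite Gab subee.
apply: (@continuous_FTC2 _ (fun s => w q * F (s, p))
  (fun s => w q * G (s, p))) => //.
- apply: continuous_subspaceT => r; apply: cvgM; first exact: cvg_cst.
  apply: (@continuous_comp _ _ _ (fun s => (s, p)) F); last exact: cF.
  have cp : p @[_ --> r] --> p by exact: cvg_cst.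
  exact: (cvg_pair (@cvg_id _ (nbhs r)) cp).
- split.
  + by move=> r _; exact: (@ex_derive _ _ _ _ _ _ _ (dwG r)).
  + by apply: cvg_at_right_filter; exact: cwG.
  + by apply: cvg_at_left_filter; exact: cwG.
- by move=> r _; rewrite derive1E; exact: (@derive_val _ _ _ _ _ _ _ (dwG r)).
Qed.

End IntegralOfDerivative.

(** * Translating both points by the same vector *)

Section CommonTranslation.
Variable R : realType.
Local Notation V := 'rV[R]_3.
Local Notation mR := (measurableTypeR R).
Local Notation mR3 := (mR * mR * mR)%type.

Definition shift_coord (k : 'I_3) (r : R) (j : nat) : mR -> mR :=
  if k == j :> nat then tshift r else id.

Definition shift3 (k : 'I_3) (r : R) (a : mR3) : mR3 :=
  (shift_coord k r 0 a.1.1, shift_coord k r 1 a.1.2, shift_coord k r 2 a.2).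

Lemma preserving_shift_coord k r j : 0 <= r <= 1 ->
  preserving (leb1 R) (@unit_itv R) (shift_coord k r j).
Proof.
move=> r01; rewrite /shift_coord; case: ifP => _; last by split.
exact: preserving_tshift.
Qed.

Lemma preserving_shift3 k r : 0 <= r <= 1 ->
  preserving (leb6 R) (@cube R `*` @cube R)
    (fun q => (shift3 k r q.1, shift3 k r q.2)).
Proof.
move=> r01; have mI := @measurable_unit_itv R.
have P3 : preserving (leb3 R) (@cube R) (shift3 k r).
  apply: (@preserving_prod _ _ _ _ _ _ _ _ _
    (fun q => (shift_coord k r 0 q.1, shift_coord k r 1 q.2))) => //.
  - exact: measurableX.
  - by apply: preserving_prod => //; exact: preserving_shift_coord.
  - exact: preserving_shift_coord.
by apply: preserving_prod => //; exact: measurable_cube.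
Qed.

(** The torus translation changes coordinate [k] by [r] or by [r - 1], and a periodic function does
    not see the difference. *)
Lemma periodic_shift3 (E : zmodType) (f : V -> E) k r a : tperiodic f ->
  f (vec (shift3 k r a)) = f (vec a + r *: e R k).
Proof.
move=> pf.
have -> : vec (shift3 k r a) =
    vec a + (tshift r (vec a 0 k) - vec a 0 k) *: e R k.
  rewrite {1}/vec /shift3 /shift_coord.
  apply/rowP => -[[|[|[|//]]] ltj]; case: k => [[|[|[|//]]] ltk];
    rewrite !mxE /= ?mulr1 ?mulr0 ?addr0// addrC subrK//.
rewrite /tshift; case: ifP => _.
  by rewrite [vec a 0 k + r]addrC addrK.
rewrite -[LHS](pf k) -addrA; congr (f (_ + _)).
by rewrite -[X in _ + X]scale1r -scalerDl; congr (_ *: _); ring.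
Qed.

(** The subtraction is done coordinatewise in [mR3], and [borel h] then applies to [h \o @vec R]. *)
Lemma measurable_separation (h : V -> R) : borel h ->
  measurable_fun setT (fun q : mR3 * mR3 => h (vec q.1 - vec q.2)).
Proof.
move=> mh; pose d (q : mR3 * mR3) : mR3 :=
  ((q.1.1.1 - q.2.1.1, q.1.1.2 - q.2.1.2), q.1.2 - q.2.2).
have -> : (fun q : mR3 * mR3 => h (vec q.1 - vec q.2)) = (h \o @vec R) \o d.
  apply/funext => q /=; congr h.
  by apply/rowP => -[[|[|[|//]]] lti]; rewrite !mxE.
apply: measurableT_comp; first exact: mh.
have m1 : measurable_fun setT (fun q : mR3 * mR3 => q.1.1.1 : mR).
  by do !apply: measurableT_comp => //.
have m2 : measurable_fun setT (fun q : mR3 * mR3 => q.2.1.1 : mR).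
  by do !apply: measurableT_comp => //.
have m3 : measurable_fun setT (fun q : mR3 * mR3 => q.1.1.2 : mR).
  by do !apply: measurableT_comp => //.
have m4 : measurable_fun setT (fun q : mR3 * mR3 => q.2.1.2 : mR).
  by do !apply: measurableT_comp => //.
have m5 : measurable_fun setT (fun q : mR3 * mR3 => q.1.2 : mR).
  by do !apply: measurableT_comp => //.
have m6 : measurable_fun setT (fun q : mR3 * mR3 => q.2.2 : mR).
  by do !apply: measurableT_comp => //.
apply: measurable_fun_pair; last exact: measurable_funB.
by apply: measurable_fun_pair; exact: measurable_funB.
Qed.

(** Along the translates of [p] by [s *: (e R k, e R k)], the derivative [F (s, p)] is the
    [s]-derivative of [G (s, p)], so [integral_derivative_eq0] applies with [s] in the role of
    time. *)
Lemma integral_common_derivative_eq0 (k : 'I_3) (h : V -> R) (g : V * V -> R) :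
  tperiodic h -> borel h -> (exists M : R, forall r, `|h r| <= M) ->
  tperiodic2 (fun x y => g (x, y)) ->
  (forall q, differentiable g q) ->
  continuous ('D_(e R k, e R k) g) ->
  (\int[leb6 R]_(q in @cube R `*` @cube R)
    (h (vec q.1 - vec q.2) *
     'D_(e R k, e R k) g (vec q.1, vec q.2))%:E = 0)%E.
Proof.
move=> ph mh [M hM] [pg1 pg2] dg cD.
set D := 'D_(e R k, e R k) g in cD *.
pose w (q : mR3 * mR3) := h (vec q.1 - vec q.2).
have mw : measurable_fun setT w by exact: measurable_separation.
pose G (q : R * (V * V)) := g (q.2 + q.1 *: (e R k, e R k)).
pose F (q : R * (V * V)) := D (q.2 + q.1 *: (e R k, e R k)).
have cF : continuous F.
  move=> q; apply: (@continuous_comp _ _ _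
    (fun q : R * (V * V) => q.2 + q.1 *: (e R k, e R k)) D); last exact: cD.
  apply: cvgD; first exact: cvg_snd.
  by apply: cvgZr_tmp; exact: cvg_fst.
have pD j x y : D (x + e R j, y) = D (x, y) /\ D (x, y + e R j) = D (x, y).
  have -> : (x + e R j, y) = (x, y) + (e R j, 0).
    by congr pair; rewrite /= addr0.
  have -> : (x, y + e R j) = (x, y) + (0, e R j).
    by congr pair; rewrite /= addr0.
  split; apply: derive_periodic => -[x' y'] /=.
    by rewrite -[RHS](pg1 y' j) -[y' in RHS]addr0.
  by rewrite -[RHS](pg2 x' j) -[x' in RHS]addr0.
have pDl y : tperiodic (fun x => D (x, y)) by move=> j x; exact: (pD j x y).1.
have pDr x : tperiodic (fun y => D (x, y)) by move=> j y; exact: (pD j x y).2.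
have [pS pSr] := tperiodic2_separation ph.
have wM : exists M : R, forall q, `|w q| <= M by exists M => q; exact: hM.
have I0 : (\int[leb_time_space2 R]_(q in
    `[0%R, 1%R]%classic `*` (@cube R `*` @cube R))
    (w q.2 * F (embed q))%:E = 0)%E.
  apply: (@integral_derivative_eq0 _ w G F 0 1) => //.
    by move=> p r; exact: is_derive_line.
  (* At [s = 1] each of the two points has moved by a full period. *)
  move=> [x y]; rewrite /G /= scale1r scale0r addr0.
  exact: etrans (pg1 (y + e R k) k x) (pg2 x k y).
pose Q (q : mR3 * mR3) := (w q * D (vec q.1, vec q.2))%:E.
have mQ : measurable_fun setT Q.
  apply/measurable_EFinP; apply: measurable_funM => //.
  have mD : measurable_fun setT ((D \o snd) \o @embed R).
    apply: measurable_embed => q.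
    by apply: continuous_comp; [exact: cvg_snd|exact: cD].
  have m0 : measurable_fun setT (fun q : mR3 * mR3 => ((0 : mR), q)).
    exact: measurable_fun_pair.
  exact: (measurableT_comp mD m0).
have intF := @integrable_embed R w F 0 1 mw wM cF.
have := I0; rewrite (fubini_setX _ _ intF).1;
  [|exact: measurable_itv|exact: measurable_cube2].
(* Since [shift3] preserves the integral of [Q], the inner integral is the same for every [r]; its
   average over an interval of length 1 is the integral sought. *)
rewrite (_ : (\int[_]_(r in _) _)%E =
    \int[leb1 R]_(r in `[0%R, 1%R]%classic)
      cst (\int[leb6 R]_(q in @cube R `*` @cube R) Q q)%E r)%E.
  rewrite integral_cst; last exact: measurable_itv.
  rewrite [X in (_ * X)%E](_ : _ = 1%E) ?mule1// -unit_itvE.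
  exact: leb1_unit_itv.
apply: eq_integral => r Ir.
have r01 : 0 <= r <= 1 by move: Ir; rewrite inE /= in_itv.
rewrite -(preserving_integral (preserving_shift3 k r01) mQ).
apply: eq_integral => q _; rewrite /Q.
have wE : w (shift3 k r q.1, shift3 k r q.2) = w q.
  rewrite /w /= (@periodic_shift3 _ (fun x => h (x - _)) _ _ _ (pS _)).
  rewrite (@periodic_shift3 _ (fun y => h (_ - y)) _ _ _ (pSr _)).
  by rewrite opprD addrACA subrr addr0.
have DE : D (vec (shift3 k r q.1), vec (shift3 k r q.2)) = F (embed (r, q)).
  rewrite (@periodic_shift3 _ (fun x => D (x, _)) _ _ _ (pDl _)).
  by rewrite (@periodic_shift3 _ (fun y => D (_, y)) _ _ _ (pDr _)).
by rewrite wE DE.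
Qed.

End CommonTranslation.

(** * Bounded profiles as distributional solutions *)

Section WeakProfile.
Variable R : realType.
Local Notation V := 'rV[R]_3.
Local Notation mR := (measurableTypeR R).
Local Notation mR3 := (mR * mR * mR)%type.
Implicit Type f : R * (V * V) -> R.

(** Derivatives in time or in space alone become directional derivatives of the joint function [f],
    the one whose smoothness is given for test functions. *)
Lemma derive_time f (t : R) (x y : V) :
  derive1 (fun s => f (s, (x, y))) t = 'D_(1, (0, 0)) f (t, (x, y)).
Proof.
rewrite derive1E -[LHS]/('D_1 (f \o (fun s : R => (s, (x, y)))) t).
apply: derive_line => s.
by congr (_, (_, _)); rewrite /= scaler0 add0r.
Qed.

Lemma derive_slice f (t : R) (p v : V * V) :
  'D_v (fun p => f (t, p)) p = 'D_(0, v) f (t, p).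
Proof.
rewrite -[LHS]/('D_v (f \o pair t) p).
by apply: derive_line => s; congr (_, _); rewrite /= scaler0 add0r.
Qed.

Lemma differentiable_slice f (t : R) (p : V * V) :
  differentiable f (t, p) -> differentiable (fun p => f (t, p)) p.
Proof.
move=> df; apply: (@differentiable_comp _ _ _ _ (pair t) f) => //.
exact: differentiable_pair.
Qed.

Lemma dsum_slice (k : 'I_3) f t : (forall q, differentiable f q) ->
  dsum k (fun x y => f (t, (x, y))) =
  fun x y => 'D_(0, (e R k, e R k)) f (t, (x, y)).
Proof.
move=> df; apply/funext => x; apply/funext => y.
have uE : uncurry2 (fun x y => f (t, (x, y))) = fun p => f (t, p).
  by apply/funext => -[].
rewrite dsumE uE; last exact: differentiable_slice.
by rewrite -derive_slice deriveE//; exact: differentiable_slice.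
Qed.

Lemma tperiodic2_dsum (k : 'I_3) (F : V -> V -> R) :
  tperiodic2 F -> tperiodic2 (dsum k F).
Proof.
move=> [pF1 pF2]; split=> [y j x|x j y]; rewrite /dsum /d1 /d2.
  have -> : F (x + e R j) = F x by apply/funext => y'; exact: pF1.
  by rewrite derive_periodic// => x'; exact: pF1.
have -> : F^~ (y + e R j) = F^~ y by apply/funext => x'; exact: pF2.
by rewrite [X in _ + X]derive_periodic// => y'; exact: pF2.
Qed.

(** On the closed time interval a continuous [f] is bounded, hence integrable against [w]; this is
    what makes the condition stable under linear combinations. *)
Definition null_against (T : R) (w : mR3 * mR3 -> R) f : Prop :=
  continuous f /\
  (\int[leb_time_space2 R]_(q in `[0%R, T]%classic `*` (@cube R `*` @cube R))
    (w q.2 * f (embed q))%:E = 0)%E.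

Lemma null_against_comb (T : R) (w : mR3 * mR3 -> R) f g (c : R) :
  measurable_fun setT w -> (exists M : R, forall q, `|w q| <= M) ->
  null_against T w f -> null_against T w g ->
  null_against T w (fun q => f q + c * g q).
Proof.
move=> mw wM [cf If] [cg Ig].
have cfg : continuous (fun q => f q + c * g q).
  move=> q; apply: cvgD; first exact: cf.
  by apply: cvgM; [exact: cvg_cst|exact: cg].
split=> //.
have mD : measurable (`[0%R, T]%classic `*` (@cube R `*` @cube R)
    : set (mR * (mR3 * mR3))).
  by apply: measurableX; [exact: measurable_itv|exact: measurable_cube2].
have intf := @integrable_embed R w f 0 T mw wM cf.
have intg := @integrable_embed R w g 0 T mw wM cg.
transitivity (\int[leb_time_space2 R]_(q in
    `[0%R, T]%classic `*` (@cube R `*` @cube R))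
  ((w q.2 * f (embed q))%:E + c%:E * (w q.2 * g (embed q))%:E))%E.
  apply: eq_integral => q _; rewrite -EFinM -EFinD; congr EFin.
  by rewrite mulrDr mulrCA.
rewrite integralD//; last exact: integrableZl.
by rewrite integralZl// If Ig mule0 adde0.
Qed.

(** With time as the inner variable, the endpoints 0 and [T] contribute nothing to any inner
    integral. *)
Lemma integral_open_slab (T : R) (w : mR3 * mR3 -> R) f :
  measurable_fun setT w -> (exists M : R, forall q, `|w q| <= M) ->
  null_against T w f ->
  (\int[leb_time_space2 R]_(q in open_slab T (@cube R `*` @cube R))
    (w q.2 * f (embed q))%:E = 0)%E.
Proof.
move=> mw wM [cf If].
have intf := @integrable_embed R w f 0 T mw wM cf.
have slabE : open_slab T (@cube R `*` @cube R) =
    `]0%R, T[%classic `*` (@cube R `*` @cube R).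
  by [].
have mI : measurable (`[0, T]%classic : set mR) by exact: measurable_itv.
have mI' : measurable (`]0, T[%classic : set mR) by exact: measurable_itv.
have mC := @measurable_cube2 R.
have intf' : (leb_time_space2 R).-integrable
    (`]0%R, T[%classic `*` (@cube R `*` @cube R))
    (fun q => (w q.2 * f (embed q))%:E).
  apply: integrableS intf; [exact: measurableX|exact: measurableX|].
  move=> q [q1 q2]; split=> //; move: q1.
  by rewrite /= !in_itv/= => /andP[/ltW -> /ltW ->].
rewrite slabE (fubini_setX mI' mC intf').2 -[RHS]If (fubini_setX mI mC intf).2.
apply: eq_integral => q _; apply/esym/integral_itv_bndoo.
apply: measurable_funTS; apply/measurable_EFinP.
apply: (@measurable_funM _ _ _ _ (fun=> w q) (fun t => f (embed (t, q)))) => //.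
have mq : measurable_fun setT (fun t : mR => (t, q)).
  exact: measurable_fun_pair.
exact: (measurableT_comp (measurable_embed cf) mq).
Qed.

Lemma bounded_profile_solution (nu T : R) (h : V -> R) : 0 < T ->
  tperiodic h -> borel h -> (exists M : R, forall r, `|h r| <= M) ->
  weak_model_solution nu T (fun _ x y => h (x - y)).
Proof.
move=> T0 ph mh [M hM].
pose w (q : mR3 * mR3) := h (vec q.1 - vec q.2).
have mw : measurable_fun setT w by exact: measurable_separation.
have wM : exists M : R, forall q, `|w q| <= M by exists M => q; exact: hM.
split.
- by move=> t _; exact: tperiodic2_separation.
- apply: measurable_funTS.
  exact: (measurableT_comp mw (@measurable_snd _ _ _ _)).
- by exists M => t x y _; exact: hM.
move=> phi [sphi pphi [a [b [a0 bT phi0]]]].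
pose f (q : R * (V * V)) := phi q.1 q.2.1 q.2.2.
have df := smooth_differentiable sphi.
pose v k : R * (V * V) := (0, (e R k, e R k)).
pose ft := 'D_((1, (0, 0)) : R * (V * V)) f.
pose fk k := 'D_(v k) ('D_(v k) f).
have sfk k : smooth setT ('D_(v k) f) by exact: smooth_derive.
have null_ft : null_against T w ft.
  split; first exact/smooth_continuous/smooth_derive.
  apply: (@integral_derivative_eq0 _ w f ft 0 T) => //.
  - exact/smooth_continuous/smooth_derive.
  - move=> [x y] r; rewrite /ft -derive_time derive1E; apply: derivableP.
    apply/derivable1_diffP.
    apply: (@differentiable_comp _ _ _ _ (fun s : R => (s, (x, y))) f).
      exact: differentiable_pair.
    exact: df.
  (* Both 0 and [T] lie outside the support interval [[a, b]]. *)
  - move=> [x y]; rewrite /f /= !phi0//.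
      by rewrite negb_and -ltNge a0.
    by rewrite negb_and -!ltNge bT orbT.
have null_fk k : null_against T w (fk k).
  have cfk : continuous (fk k) by exact/smooth_continuous/smooth_derive.
  split=> //.
  have intf := @integrable_embed R w (fk k) 0 T mw wM cfk.
  (* Here space is the inner variable: the integral already vanishes at each fixed [t]. *)
  rewrite (fubini_setX _ _ intf).1;
    [|exact: measurable_itv|exact: measurable_cube2].
  apply: integral0_eq => t _.
  have DkE : 'D_(e R k, e R k) (fun p => 'D_(v k) f (t, p)) =
      fun p => fk k (t, p).
    by apply/funext => p; exact: (derive_slice ('D_(v k) f)).
  transitivity (\int[leb6 R]_(q in @cube R `*` @cube R)
    (h (vec q.1 - vec q.2) * 'D_(e R k, e R k)
       (fun p => 'D_(v k) f (t, p)) (vec q.1, vec q.2))%:E)%E.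
    apply: eq_integral => q _.
    exact: (congr1 (fun z => (w q * z)%:E)
      (esym (derive_slice ('D_(v k) f) _ _ _))).
  apply: (@integral_common_derivative_eq0 R k h (fun p => 'D_(v k) f (t, p))).
  - exact: ph.
  - exact: mh.
  - by exists M.
  - have -> : (fun x y => 'D_(v k) f (t, (x, y))) = dsum k (phi t).
      exact: (esym (dsum_slice k t df)).
    exact: tperiodic2_dsum.
  - move=> p.
    exact: (differentiable_slice (smooth_differentiable (sfk k) (_, p))).
  - rewrite DkE => p.
    have ct : (t : R) @[_ --> p] --> (t : R) by exact: cvg_cst.
    exact: (cvg_comp _ _ (cvg_pair ct (@cvg_id _ (nbhs p))) (cfk (_, _))).
(* The adjoint operator is put in the left-nested form produced by four uses of
   [null_against_comb]. *)
have lincomb (F : 'I_3 -> R) (c : R) :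
    - c - nu * \sum_k F k = c + (-2) * c + (- nu) * F ord0
      + (- nu) * F (lift ord0 ord0) + (- nu) * F (lift ord0 (lift ord0 ord0)).
  by rewrite !big_ord_recl big_ord0; ring.
(* The first coefficient of null_against_comb is 1: - ft = ft - 2 ft. *)
have n0 := null_against_comb (-2) mw wM null_ft null_ft.
have n1 := null_against_comb (- nu) mw wM n0 (null_fk ord0).
have n2 := null_against_comb (- nu) mw wM n1 (null_fk (lift ord0 ord0)).
have := null_against_comb (- nu) mw wM n2
  (null_fk (lift ord0 (lift ord0 ord0))).
move=> /(integral_open_slab mw wM); apply: etrans.
apply: eq_integral => q _; congr EFin; congr (_ * _).
have -> : derive1 (fun s => phi s (vec q.2.1) (vec q.2.2)) q.1 = ft (embed q).
  exact: (derive_time f).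
have -> : common_diffusion (phi q.1) (vec q.2.1) (vec q.2.2) =
    \sum_k fk k (embed q).
  apply: eq_bigr => k _.
  rewrite -[phi q.1]/(fun x y => f (q.1 : R, (x, y))) (dsum_slice k q.1 df).
  exact: (congr1 (fun g : V -> V -> R => g (vec q.2.1) (vec q.2.2))
    (dsum_slice k q.1 (smooth_differentiable (sfk k)))).
exact: (lincomb (fun k => fk k (embed q))).
Qed.

End WeakProfile.

(** * Failure of separation estimates *)

Section NoModulus.
Variable R : realType.
Local Notation V := 'rV[R]_3.
Local Notation mR := (measurableTypeR R).
Local Notation mR3 := (mR * mR * mR)%type.

Definition wave (a b : R) (n : nat) : V -> R :=
  trig a b \o phase (pi *+ 2 *+ n).

Lemma measurable_wave (a b : R) n :
  measurable_fun setT (fun q : mR3 * mR3 => wave a b n (vec q.1 - vec q.2)).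
Proof.
have cf : continuous (wave a b n \o @separation R).
  move=> q; apply: continuous_comp; first exact: continuous_separation.
  exact: (smooth_continuous (smooth_trig_phase a b (pi *+ 2 *+ n))).
have m0 : measurable_fun setT (fun q : mR3 * mR3 => ((0 : mR), q)).
  exact: measurable_fun_pair.
exact: (measurableT_comp (measurable_embed cf) m0).
Qed.

(** The increment is over half a wavelength, so the wave becomes its opposite and the difference is
    twice its value. *)
Lemma separation_increment_wave (a b : R) n : (0 < n)%N ->
  separation_increment (fun x y => wave a b n (x - y))
    ((2 * n%:R)^-1 *: e R 0) =
  (\int[leb6 R]_(q in @cube R `*` @cube R)
     (2 * `|wave a b n (vec q.1 - vec q.2)|)%:E)%E.
Proof.
move=> n0; apply: eq_integral => q _; congr EFin.
have -> (x y z : V) : x + 2^-1 *: z - (y - 2^-1 *: z) = x - y + z.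
  by apply/matrixP => i j; rewrite !mxE; lra.
rewrite /wave trig_half_period// -opprD normrN -mulr2n normrMn.
by rewrite mulr_natl.
Qed.

(** Numbers in [0, 1] dominate their squares, and the squares add up to 1. *)
Lemma cos_sin_norm_ge1 (s : R) : 1 <= `|cos s| + `|sin s|.
Proof.
rewrite -(cos2Dsin2 s) -(real_normK (num_real (cos s))).
rewrite -(real_normK (num_real (sin s))).
have := cos_max s; have := sin_max s.
have := normr_ge0 (cos s); have := normr_ge0 (sin s).
by nra.
Qed.

(** Using both waves replaces the integral of [|cos|] by a pointwise bound, integrated over a domain
    of measure 1. *)
Lemma separation_increment_waves_ge (M : R) n : 0 < M -> (0 < n)%N ->
  ((2 * M)%:E <=
   separation_increment (fun x y => wave M 0 n (x - y))
     ((2 * n%:R)^-1 *: e R 0)%R +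
   separation_increment (fun x y => wave 0 M n (x - y))
     ((2 * n%:R)^-1 *: e R 0)%R)%E.
Proof.
move=> M0 n0; rewrite !separation_increment_wave//.
have mw a b : measurable_fun (@cube R `*` @cube R : set (mR3 * mR3))
    (fun q => (2 * `|wave a b n (vec q.1 - vec q.2)|)%:E).
  apply: measurable_funTS; apply/measurable_EFinP; apply: measurable_funM => //.
  by apply: measurableT_comp => //; exact: measurable_wave.
have mC := @measurable_cube2 R.
rewrite -ge0_integralD//; try by move=> q _; rewrite lee_fin mulr_ge0.
have -> : ((2 * M)%:E =
    \int[leb6 R]_(q in @cube R `*` @cube R) cst (2 * M)%:E q)%E.
  rewrite integral_cst// [X in (_ * X)%E](_ : _ = 1%E) ?mule1//.
  exact: leb6_cube2.
apply: ge0_le_integral => //.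
- by move=> q _; rewrite lee_fin mulr_ge0// ltW.
- exact: emeasurable_funD.
move=> q _; rewrite -EFinD lee_fin /= -mulrDr ler_pM2l//.
rewrite /wave /trig /= !mul0r addr0 add0r !normrM (gtr0_norm M0) -mulrDr.
by rewrite ler_peMr ?(ltW M0)//; exact: cos_sin_norm_ge1.
Qed.

Lemma wave_solution (nu T a b : R) n :
  smooth_model_solution nu T (fun _ x y => wave a b n (x - y)).
Proof.
by apply: smooth_profile_solution;
  [exact: periodic_trig_phase|exact: smooth_trig_phase].
Qed.

(** For large [n] the shift [z] is so short that [omega] is below [M] there; the estimate for the
    two waves would then give [2 M <= 2 omega |z| < 2 M]. *)
Lemma no_separation_modulus (nu T t M : R) (omega : R -> R) :
  0 < M -> omega s @[s --> 0^'+] --> 0 ->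
  ~ (forall H : R -> V -> V -> R, smooth_model_solution nu T H ->
       (forall s x y, 0 <= s <= T -> `|H s x y| <= M) ->
       forall z : V, (separation_increment (H t) z <= (omega `|z|)%:E)%E).
Proof.
move=> M0 omega0 est.
have e0 : 0 < `|e R 0|.
  rewrite normr_gt0; apply/eqP => /matrixP/(_ 0 0)/eqP.
  by rewrite !mxE oner_eq0.
have [d /= d0 omegaM] : \forall s \near 0^'+, `|0 - omega s| < M.
  by move/cvgrPdist_lt : omega0; apply.
(* The left side is the norm of the half-wavelength shift [z]; the successor in the witness ensures
   [0 < n]. *)
have [n n0 nd] : exists2 n : nat, (0 < n)%N & (2 * n%:R)^-1 * `|e R 0| < d.
  exists (Num.bound (`|e R 0| / d)).+1 => //.
  rewrite mulrC ltr_pdivrMr ?mulr_gt0// mulrC -ltr_pdivrMr//.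
  rewrite (lt_le_trans (archi_boundP _)) ?divr_ge0 ?(ltW d0)//.
  by rewrite -natrM ler_nat (leq_trans (leqnSn _))// leq_pmull.
set z := (2 * n%:R)^-1 *: e R 0.
have zE : `|z| = (2 * n%:R)^-1 * `|e R 0|.
  by rewrite normrZ ger0_norm// invr_ge0 mulr_ge0.
have omegaz : omega `|z| < M.
  have z0 : 0 < `|z| by rewrite zE mulr_gt0// invr_gt0 mulr_gt0// ltr0n.
  have := omegaM `|z|; rewrite /= sub0r normrN sub0r !normrN normr_id zE.
  move=> /(_ nd).
  rewrite -zE => /(_ z0); exact: le_lt_trans (ler_norm _).
(* With one coefficient zero the amplitude is that of the other; in general it would be the square
   root of [a^2 + b^2]. *)
have bound a b : (a == 0) || (b == 0) -> `|a| <= M -> `|b| <= M ->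
    forall r : V, `|wave a b n r| <= M.
  move=> /orP[]/eqP-> aM bM r; rewrite /wave /trig /= mul0r
    ?add0r ?addr0 normrM.
    by rewrite -[M]mulr1 ler_pM// sin_max.
  by rewrite -[M]mulr1 ler_pM// cos_max.
have MM : `|M| <= M by rewrite gtr0_norm.
have OM : `|0 : R| <= M by rewrite normr0 ltW.
have b1 := bound M 0 (introT orP (or_intror (eqxx 0))) MM OM.
have b2 := bound 0 M (introT orP (or_introl (eqxx 0))) OM MM.
have ec := est _ (wave_solution nu T M 0 n) (fun _ _ _ _ => b1 _) z.
have es := est _ (wave_solution nu T 0 M n) (fun _ _ _ _ => b2 _) z.
have := le_trans (separation_increment_waves_ge M0 n0) (leeD ec es).
by rewrite -EFinD lee_fin; lra.
Qed.

End NoModulus.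

Theorem proposition4p2 (R : realType) (nu T : R)
    (u : R -> 'rV[R]_3 -> 'rV[R]_3) (p : R -> 'rV[R]_3 -> R)
    (hnu : 0 < nu) (hT : 0 < T) (hNS : navier_stokes nu T u p) :
  (* the common-noise diffusion in centre and separation variables *)
  (forall F : 'rV[R]_3 -> 'rV[R]_3 -> R,
     tperiodic2 F ->
     Ck setT 2 (fun q : 'rV[R]_3 * 'rV[R]_3 => F q.1 q.2) ->
     forall x y, let c := 2^-1 *: (x + y) in let r := x - y in
       common_diffusion F x y = laplacian1 (in_cr F) c r) /\
  (* the transport terms *)
  (forall (t : R) (F : 'rV[R]_3 -> 'rV[R]_3 -> R),
     0 <= t <= T -> tperiodic2 F ->
     Ck setT 1 (fun q : 'rV[R]_3 * 'rV[R]_3 => F q.1 q.2) ->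
     forall x y, let c := 2^-1 *: (x + y) in let r := x - y in
       let up := u t (c + 2^-1 *: r) in let um := u t (c - 2^-1 *: r) in
       advect1 (u t x) F x y + advect2 (u t y) F x y =
       advect1 (2^-1 *: (up + um)) (in_cr F) c r
       + advect2 (up - um) (in_cr F) c r) /\
  (* the joint operator: its diffusion is a Laplacian in c alone *)
  (forall H : R -> 'rV[R]_3 -> 'rV[R]_3 -> R,
     (forall t, 0 < t < T -> tperiodic2 (H t)) ->
     (forall t x y, 0 < t < T -> derivable (fun s => H s x y) t 1) ->
     (forall t, 0 < t < T ->
        Ck setT 2 (fun q : 'rV[R]_3 * 'rV[R]_3 => H t q.1 q.2)) ->
     forall t x y, 0 < t < T ->
       let c := 2^-1 *: (x + y) in let r := x - y in
       let up := u t (c + 2^-1 *: r) in let um := u t (c - 2^-1 *: r) in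
       let K := fun s => in_cr (H s) in
       two_point_op nu u H t x y =
       derive1 (fun s => K s c r) t
       + (advect1 (2^-1 *: (up + um)) (K t) c r
          + advect2 (up - um) (K t) c r)
       - nu * laplacian1 (K t) c r) /\
  (* stationary solutions of the model equation: smooth profiles *)
  (forall h : 'rV[R]_3 -> R, tperiodic h -> smooth setT h ->
     smooth_model_solution nu T (fun _ x y => h (x - y))) /\
  (* bounded profiles, in the sense of distributions *)
  (forall h : 'rV[R]_3 -> R, tperiodic h -> borel h ->
     (exists M : R, forall r, `|h r| <= M) ->
     weak_model_solution nu T (fun _ x y => h (x - y))) /\
  (* no a priori estimate of a modulus of continuity in the separation
     variable, at any time t and even in L^1, for bounded solutions of the
     model equation, including smooth ones *)
  (forall (t M : R) (omega : R -> R),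
     0 < t < T -> 0 < M -> omega s @[s --> 0^'+] --> 0 ->
     ~ (forall H : R -> 'rV[R]_3 -> 'rV[R]_3 -> R,
          smooth_model_solution nu T H ->
          (forall s x y, 0 <= s <= T -> `|H s x y| <= M) ->
          forall z : 'rV[R]_3,
            (separation_increment (H t) z <= (omega `|z|)%:E)%E)).
Proof.
split=> [F _ CF x y|]; first exact: common_diffusion_cr.
split=> [t F _ _ CF x y c r|].
  by rewrite /c /r !centre_separation; exact: transport_cr.
split=> [H _ _ CH t x y t0T c r|].
  (* [K s c r] is [H s x y], so the time derivatives coincide and the two spatial identities
     remain. *)
  rewrite /two_point_op /c /r !centre_separation /in_cr !centre_separation.
  rewrite (transport_cr _ _ _ _ (CkW (CH t t0T))).
  by rewrite (common_diffusion_cr _ _ (CH t t0T)).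
split=> [h ph sh|]; first exact: smooth_profile_solution.
split=> [h ph mh hM|]; first exact: bounded_profile_solution.
by move=> t M omega _ M0 omega0; exact: no_separation_modulus.
Qed.
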